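(* Let $X$ be a locally compact Hausdorff connected space and let $\mu$ be a topological measure on $X$. (A) If $\mu(X)<\infty$, then $\rho_\mu$ is a quasi-linear functional on $C_0(X)$ with $\|\rho_\mu\|\le\mu(X)$. (B) If $\mu$ is compact-finite, then $\rho_\mu$ is a quasi-linear functional on $C_c(X)$ such that $\rho_\mu(f)\le\|f\|\,m_f(\operatorname{supp} m_f)$ for every $f\in C_c(X)$.
   Context: $C_0(X)$, $C_c(X)$, $C_b(X)$ are the real-valued continuous functions on $X$ vanishing at infinity, with compact support, and bounded, respectively, with the uniform norm $\|\cdot\|$ (all equal to $C(X)$ if $X$ is compact). Singly generated subalgebra: for $f\in C_b(X)$, $S(f)$ is the smallest uniformly closed subalgebra of $C_b(X)$ containing $f$ and, if $X$ is compact, also containing the constant $1$. (If $X$ is compact, $S(f)=\{\phi\circ f:\phi\in C(f(X))\}$; if $X$ is not compact and $f\in C_0(X)$ or $C_c(X)$, $S(f)=\{\phi\circ f:\phi\in C(\overline{f(X)}),\ \phi(0)=0\}$, which lies in $C_0(X)$, resp. $C_c(X)$.) Quasi-linear functional on $\mathcal B$ ($\mathcal B=C_0(X)$ or $C_c(X)$): a map $\rho:\mathcal B\to\mathbb R$ with $\rho(af)=a\rho(f)$ for $a\in\mathbb R$, $f\in\mathcal B$; $\rho(f+g)=\rho(f)+\rho(g)$ whenever $f,g\in S(h)$ for some $h\in\mathcal B$; and $\rho(f)\ge0$ whenever $f\ge0$. Its norm is $\|\rho\|=\sup\{\rho(f): f\in\mathcal B,\ 0\le f\le1\}\in[0,\infty]$.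 Topological measure on $X$: a set function $\mu$ from the open and closed subsets of $X$ to $[0,\infty]$, not identically $\infty$, such that (TM1) $\mu(A\sqcup B)=\mu(A)+\mu(B)$ whenever $A,B$ are disjoint and each of $A,B,A\sqcup B$ is compact or open; (TM2) $\mu(U)=\sup\{\mu(K):K\subseteq U \text{ compact}\}$ for $U$ open; (TM3) $\mu(F)=\inf\{\mu(U):U\supseteq F\text{ open}\}$ for $F$ closed. It is compact-finite if $\mu(K)<\infty$ for all compact $K$. Functional $\rho_\mu$: it is defined on $C_0(X)$ if $\mu$ is finite (case (A)), and on $C_c(X)$ if $\mu$ is compact-finite (case (B)), by $\rho_\mu(f)=\int_{\mathbb R}t\,dm_f(t)$, where $m_f$ is the Stieltjes measure on $\mathbb R$ with $m_f((s,t])=F(s)-F(t)$ for $s<t$, and $F(a)=\mu(f^{-1}((a,\infty)))$ in case (A), $F(a)=\mu(f^{-1}((a,\infty)\setminus\{0\}))$ in case (B). (Here $F$ is non-increasing, right-continuous and real-valued; $\operatorname{supp} m_f$ is the support of the measure $m_f$.) *)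

(* Defs.v *)
From HB Require Import structures.
From mathcomp Require Import all_boot all_order all_algebra.
From mathcomp Require Import all_classical all_reals all_analysis.

Set Implicit Arguments.
Unset Strict Implicit.
Unset Printing Implicit Defensive.

Import Order.TTheory GRing.Theory Num.Theory.
Import numFieldNormedType.Exports.

Local Open Scope classical_set_scope.
Local Open Scope ring_scope.

Section FunctionSpaces.
Context {R : realType} {X : topologicalType}.
Implicit Types f : X -> R.

Definition Cb : set (X -> R) :=
  [set f | continuous f /\ exists M : R, forall x, `|f x| <= M].

Definition C0 : set (X -> R) :=
  [set f | continuous f /\
    forall e : R, 0 < e -> compact [set x | e <= `|f x|]].

Definition Cc : set (X -> R) :=
  [set f | continuous f /\ compact (closure [set x | f x != 0])].

Definition unorm f : R := sup (range (fun x => `|f x|)).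

Record closed_subalgebra (A : set (X -> R)) : Prop := {
  csub_Cb : A `<=` Cb ;
  csub0 : A (cst 0) ;
  csubD : forall f g, A f -> A g -> A (f \+ g) ;
  csubZ : forall (a : R) f, A f -> A (a \*o f) ;
  csubM : forall f g, A f -> A g -> A (f \* g) ;
  csub_closed : closed (A : set {uniform X -> R}) ;
  csub1 : compact [set: X] -> A (cst 1) }.

Definition gen_subalgebra f : set (X -> R) := smallest closed_subalgebra [set f].

(* A functional on B is a total function on X -> R; only its values on B are
   constrained. *)
Record quasi_linear (B : set (X -> R)) (rho : (X -> R) -> R) : Prop := {
  qlZ : forall (a : R) f, B f -> rho (a \*o f) = a * rho f ;
  qlD : forall h f g, B h -> gen_subalgebra h f -> gen_subalgebra h g ->
    rho (f \+ g) = rho f + rho g ;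
  ql_ge0 : forall f, B f -> (forall x, 0 <= f x) -> 0 <= rho f }.

Definition ql_norm (B : set (X -> R)) (rho : (X -> R) -> R) : \bar R :=
  ereal_sup [set (rho f)%:E | f in [set f | B f /\ forall x, 0 <= f x <= 1]].

End FunctionSpaces.

Section TopologicalMeasures.
Context {R : realType} {X : topologicalType}.
Local Open Scope ereal_scope.
Implicit Types (mu : set X -> \bar R) (f : X -> R).

Definition compact_or_open (A : set X) : Prop := compact A \/ open A.

(* Only the values of mu on open and closed sets are constrained; compact sets
   are closed in the Hausdorff spaces considered. *)
Record topological_measure mu : Prop := {
  tm_ge0 : forall A, open A \/ closed A -> 0 <= mu A ;
  tm_proper : exists A, (open A \/ closed A) /\ mu A <> +oo ;
  tm_add : forall A B, A `&` B = set0 -> compact_or_open A ->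
    compact_or_open B -> compact_or_open (A `|` B) ->
    mu (A `|` B) = mu A + mu B ;
  tm_inner : forall U, open U ->
    mu U = ereal_sup [set mu K | K in [set K | compact K /\ K `<=` U]] ;
  tm_outer : forall F, closed F ->
    mu F = ereal_inf [set mu U | U in [set U | open U /\ F `<=` U]] }.

Definition compact_finite mu : Prop := forall K, compact K -> mu K < +oo.

(* The function F attached to f: tailA for finite mu and f in C0, tailB for
   compact-finite mu and f in Cc. The sets have finite measure in these cases,
   so fine loses nothing. *)
Definition tailA mu f (a : R) : R := fine (mu (f @^-1` `]a, +oo[)).

Definition tailB mu f (a : R) : R := fine (mu (f @^-1` (`]a, +oo[ `\ 0%R))).

End TopologicalMeasures.

Section StieltjesMeasures.
Context {R : realType}.
Local Open Scope ereal_scope.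

Definition is_tail (F : R -> R) : Prop :=
  {homo F : s t / (s <= t)%R >-> (t <= s)%R} /\ right_continuous F.

Section oppF.
Variables (F : R -> R) (tF : is_tail F).
Definition opp_tail of is_tail F : R -> R := fun a => (- F a)%R.

Let ndF : nondecreasing (opp_tail tF).
Proof. by move=> s t st; rewrite /opp_tail lerN2; exact: tF.1. Qed.

Let rcF : right_continuous (opp_tail tF).
Proof. by move=> a; apply: cvgN; exact: tF.2. Qed.

HB.instance Definition _ := isCumulative.Build R _ R (opp_tail tF) ndF rcF.
End oppF.

(* The Stieltjes measure with m ]s, t] = F s - F t (see stieltjesE); the zero
   measure is a dummy value when F is not non-increasing and right-continuous,
   which does not occur below (see is_tailA and is_tailB). *)
Definition stieltjes (F : R -> R) :
    {measure set (measurableTypeR R) -> \bar R} :=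
  match pselect (is_tail F) with
  | left tF => lebesgue_stieltjes_measure (opp_tail tF)
  | right _ => mzero
  end.

Lemma stieltjesE (F : R -> R) (s t : R) : is_tail F -> (s < t)%R ->
  stieltjes F `]s, t]%classic = (F s - F t)%:E.
Proof.
move=> tF st; rewrite /stieltjes; case: pselect => // tF' /=.
rewrite /lebesgue_stieltjes_measure /measure_extension measurable_mu_extE/=;
  last exact: is_ocitv.
by rewrite wlength_itv_bnd ?ltW// /opp_tail opprK addrC.
Qed.

Definition msupport (m : {measure set (measurableTypeR R) -> \bar R}) :
    set R :=
  [set x | forall U : set R, open U -> U x -> 0 < m U].

End StieltjesMeasures.

Section TailFacts.
Context {R : realType} {X : topologicalType}.
Variable mu : set X -> \bar R.
Hypothesis hmu : topological_measure mu.
Local Open Scope ereal_scope.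

Let mu_compact_open K U : compact K -> open U -> K `<=` U -> mu K <= mu U.
Proof.
by move=> cK oU KU; rewrite (tm_inner hmu oU); apply: ereal_sup_ubound; exists K.
Qed.

Let mu_open_open U V : open U -> open V -> U `<=` V -> mu U <= mu V.
Proof.
move=> oU oV UV; rewrite (tm_inner hmu oU).
apply: ge_ereal_sup => _ [K [cK KU] <-].
by apply: mu_compact_open => //; exact: subset_trans UV.
Qed.

Let is_tail_open (U : R -> set X) : (forall a, open (U a)) ->
  (forall a b, (a <= b)%R -> U b `<=` U a) ->
  (forall a x, U a x -> exists2 b, (a < b)%R & U b x) ->
  (forall a, mu (U a) < +oo) -> is_tail (fun a => fine (mu (U a))).
Proof.
move=> oU dU rU fU.
have finU a : mu (U a) \is a fin_num.
  by rewrite ge0_fin_numE ?fU//; apply: (tm_ge0 hmu); left.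
have nF s t : (s <= t)%R -> (fine (mu (U t)) <= fine (mu (U s)))%R.
  by move=> st; apply: fine_le => //; apply: mu_open_open => //; exact: dU.
split=> // a; apply/cvgrPdist_le => e e0.
have [_ [K [cK KU] <-] hK] : exists2 y,
    [set mu K | K in [set K | compact K /\ K `<=` U a]] y & mu (U a) - e%:E < y.
  apply: ereal_sup_gt; rewrite -(tm_inner hmu (oU a)).
  by rewrite lteBlDr// lteDl// lte_fin.
have nearK : \forall b \near a^'+, K `<=` U b.
  move: cK => /compact_near_coveringP; apply => x /KU /rU[b ab Ubx].
  exists (U b, [set c | (c < b)%R]) => [|[y c]/= [Uy cb]]; last first.
    exact: dU (ltW cb) _ Uy.
  by split=> /=; [exact: open_nbhs_nbhs|exact: nbhs_right_lt].
near=> b.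
have ab : (a <= b)%R by apply: ltW; near: b; exact: nbhs_right_gt.
rewrite ger0_norm ?subr_ge0 ?nF// lerBlDl -lerBlDr -lee_fin EFinB !fineK//.
apply: (le_trans (ltW hK)); apply: mu_compact_open => //.
by near: b.
Unshelve. all: by end_near. Qed.

Let open_tail (f : X -> R) (a : R) : continuous f -> open (f @^-1` `]a, +oo[).
Proof. by move=> cf; apply: open_comp => // x _; exact: cf. Qed.

Lemma is_tailA f : C0 f -> mu [set: X] < +oo -> is_tail (tailA mu f).
Proof.
move=> [cf _] fin; apply: is_tail_open => [a|a b ab x|a x|a].
- exact: open_tail.
- by rewrite /= !in_itv/= !andbT; exact: le_lt_trans.
- rewrite /= in_itv/= andbT => afx; exists ((a + f x) / 2)%R; rewrite ?midf_lt//.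
  by rewrite in_itv/= andbT midf_lt.
- apply: le_lt_trans fin; apply: mu_open_open => //; last exact: openT.
  exact: open_tail.
Qed.

Lemma is_tailB f : Cc f -> compact_finite mu -> is_tail (tailB mu f).
Proof.
move=> [cf sf] fin.
have oB a : open (f @^-1` (`]a, +oo[ `\ 0%R)).
  apply: open_comp => [x _|]; first exact: cf.
  by apply: openI; [exact: interval_open|apply: closed_openC; exact: closed_eq].
apply: is_tail_open => // [a b ab x|a x|a].
- move=> -[]/=; rewrite !in_itv/= !andbT => bx x0.
  by split; rewrite /= ?in_itv/= ?andbT ?(le_lt_trans ab).
- move=> -[]/=; rewrite in_itv/= andbT => afx x0.
  exists ((a + f x) / 2)%R; rewrite ?midf_lt//.
  by split; rewrite /= ?in_itv/= ?andbT ?midf_lt.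
- have : mu (closure [set x | f x != 0%R]) < +oo by exact: fin.
  rewrite (tm_outer hmu (@closed_closure _ _)) => /ereal_inf_lt[_ [V [oV sV] <-]].
  apply: le_lt_trans; apply: mu_open_open => // x [_ /eqP fx0].
  exact/sV/subset_closure.
Qed.

End TailFacts.

Section Functionals.
Context {R : realType} {X : topologicalType}.
Implicit Types (mu : set X -> \bar R) (f : X -> R).

Definition rhoA mu f : R :=
  \int[stieltjes (tailA mu f)]_(t in setT) (t : R).

Definition rhoB mu f : R :=
  \int[stieltjes (tailB mu f)]_(t in setT) (t : R).

End Functionals.

(* Main.v *)
(* Off 0, f is described by the measure m_f alone: m_f(U) = mu(f^-1(U)) for
   every open U not containing 0.  For intervals this follows from additivity of
   mu on {f > a} and compact level sets, and it passes to open U by splitting U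
   into disjoint open intervals and using inner regularity.
   An element f of S(h) is constant on the fibers of h, so f = phi o h, and phi
   is Borel because h is proper off 0.  Then phi pushes m_h forward to a measure
   which agrees with m_f off 0, hence rho(f) is the integral of phi against m_h.
   This is linear in phi, so rho is linear on S(h).
   If X is compact, S(h) contains constants and m_h must be right at 0 too; then mu
   is finite and the measure of case (A) serves for both functionals. *)

Require Import Defs.
From mathcomp Require Import all_boot all_order all_algebra.
From mathcomp Require Import all_classical all_reals all_analysis.
From mathcomp Require Import measurable_realfun lra.

Set Implicit Arguments.
Unset Strict Implicit.
Unset Printing Implicit Defensive.

Import Order.TTheory GRing.Theory Num.Theory.
Import numFieldNormedType.Exports.

Local Open Scope classical_set_scope.
Local Open Scope ereal_scope.

(** * The algebra generated by a function *)

Section FunctionAlgebras.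
Context {R : realType} {X : topologicalType}.
Local Open Scope ring_scope.
Implicit Types f g h : X -> R.

Lemma C0_bounded f : C0 f -> exists M : R, forall x, `|f x| <= M.
Proof.
move=> [cf f0].
have /compact_bounded[M [_ hM]] : compact (f @` [set x | 1 <= `|f x|]).
  by apply: continuous_compact; [exact: continuous_subspaceT|exact: f0].
exists (Num.max 1 (M + 1)) => x; rewrite le_max.
have [hx|hx] := leP 1 `|f x|; last by rewrite ltW.
by rewrite (hM (M + 1)) ?orbT ?ltrDl//; exists x.
Qed.

Lemma C0_Cb : C0 `<=` (Cb : set (X -> R)).
Proof. by move=> f f0; split; [exact: f0.1|exact: C0_bounded]. Qed.

(** The superlevel set is closed, so any enclosing compact set suffices; sums and uniform limits
    need no more than an inclusion. *)
Lemma C0_sub_compact f : continuous f ->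
  (forall e, 0 < e -> exists2 K, compact K & [set x | e <= `|f x|] `<=` K) ->
  C0 f.
Proof.
move=> cf fK; split=> // e /fK[K cK]; apply: subclosed_compact => //.
have -> : [set x | e <= `|f x|] = (Num.norm \o f) @^-1` `[e, +oo[.
  by apply/seteqP; split=> x /=; rewrite in_itv/= andbT.
apply: closed_comp => [x _|]; last exact: interval_closed.
by apply: continuous_comp; [exact: cf|exact: norm_continuous].
Qed.

Lemma C0_le f g (M : R) : C0 f -> continuous g ->
  (forall x, `|g x| <= M * `|f x|) -> C0 g.
Proof.
move=> [_ f0] cg gf; apply: C0_sub_compact => // e e0.
have M0 : 0 < `|M| + 1 by rewrite ltr_pwDr.
exists [set x | e / (`|M| + 1) <= `|f x|]; first by apply: f0; rewrite divr_gt0.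
move=> x /= ge; rewrite ler_pdivrMr// mulrC; apply: le_trans ge (le_trans (gf x) _).
by rewrite ler_wpM2r// (le_trans (ler_norm M))// lerDl.
Qed.

Lemma C00 : C0 (cst 0 : X -> R).
Proof.
apply: C0_sub_compact; first by move=> x; exact: cst_continuous.
move=> e e0; exists set0; first exact: compact0.
by move=> x /=; rewrite normr0 leNgt e0.
Qed.

Lemma C01 : compact [set: X] -> C0 (cst 1 : X -> R).
Proof.
move=> cX; apply: C0_sub_compact; first by move=> x; exact: cst_continuous.
by move=> e e0; exists setT.
Qed.

Lemma C0D f g : C0 f -> C0 g -> C0 (f \+ g).
Proof.
move=> [cf f0] [cg g0]; apply: C0_sub_compact.
  by move=> x; apply: cvgD; [exact: cf|exact: cg].
move=> e e0; have e20 : 0 < e / 2 by rewrite divr_gt0.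
exists ([set x | e / 2 <= `|f x|] `|` [set x | e / 2 <= `|g x|]).
  by apply: compactU; [exact: f0|exact: g0].
move=> x /= efg; have [ef|fe] := leP (e / 2) `|f x|; [by left|right].
by have := ler_normD (f x) (g x); move: efg fe; lra.
Qed.

Lemma C0Z (a : R) f : C0 f -> C0 (a \*o f).
Proof.
move=> f0; apply: (C0_le (M := `|a|) f0).
  by move=> x; apply: cvgM; [exact: cvg_cst|exact: f0.1].
by move=> x /=; rewrite normrM.
Qed.

Lemma C0M f g : C0 f -> C0 g -> C0 (f \* g).
Proof.
move=> f0 g0; have [M hM] := C0_bounded g0; apply: (C0_le (M := M) f0).
  by move=> x; apply: cvgM; [exact: f0.1|exact: g0.1].
by move=> x /=; rewrite normrM mulrC ler_wpM2r.
Qed.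

Lemma uniform_closureP (A : set (X -> R)) f :
  closure (A : set {uniform X -> R}) f -> forall e, 0 < e ->
  exists2 g, A g & forall x, `|f x - g x| < e.
Proof.
move=> Af e e0.
have /Af[g [Ag fg]] : nbhs (f : {uniform X -> R}) [set g | forall x, `|f x - g x| < e].
  apply/uniform_nbhs; exists [set xy | ball xy.1 e xy.2]; split.
    exact: entourage_ball (PosNum e0).
  by move=> g /= fg x; exact: fg.
by exists g.
Qed.

Lemma C0_closed : closed (C0 : set {uniform X -> R}).
Proof.
move=> f /uniform_closureP fA; apply: C0_sub_compact.
  move=> x; apply/cvgrPdist_lt => e e0.
  have e30 : 0 < e / 3 by rewrite divr_gt0.
  have [g [cg _] fg] := fA _ e30.
  have /cvgrPdist_lt/(_ _ e30) := cg x.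
  apply: filterS => y gxy.
  have := fg x; have := fg y; move: gxy; rewrite !ltr_norml; lra.
move=> e e0; have e20 : 0 < e / 2 by rewrite divr_gt0.
have [g [_ g0] fg] := fA _ e20.
exists [set x | e / 2 <= `|g x|]; first exact: g0.
move=> x /= ef; have := fg x; have := ler_normD (f x - g x) (g x).
by rewrite subrK; move: ef; lra.
Qed.

Lemma C0_closed_subalgebra : closed_subalgebra (C0 : set (X -> R)).
Proof.
split; [exact: C0_Cb|exact: C00|exact: C0D|exact: C0Z|exact: C0M|exact: C0_closed|].
exact: C01.
Qed.

(* Contains S(h), and is visibly closed under uniform limits. [Z] is [set0] when
   constants must be allowed (compact [X]) and [[set 0]] otherwise. *)
Definition fiber_algebra h (Z : set R) : set (X -> R) :=
  [set f | [/\ C0 f, forall x y, h x = h y -> f x = f y &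
                forall x, Z (h x) -> f x = 0]].

(** Each condition survives pointwise operations and uniform limits; the hypothesis on [Z] admits
    the constant 1 when [X] is compact. *)
Lemma fiber_algebra_closed h Z : (compact [set: X] -> Z = set0) ->
  closed_subalgebra (fiber_algebra h Z).
Proof.
move=> XZ; split.
- by move=> f [f0 _ _]; exact: C0_Cb.
- by split=> //; exact: C00.
- move=> f g [f0 fh fZ] [g0 gh gZ]; split; first exact: C0D.
  + by move=> x y xy /=; rewrite (fh _ _ xy) (gh _ _ xy).
  + by move=> x Zx /=; rewrite fZ// gZ// addr0.
- move=> a f [f0 fh fZ]; split; first exact: C0Z.
  + by move=> x y xy /=; rewrite (fh _ _ xy).
  + by move=> x Zx /=; rewrite fZ// mulr0.
- move=> f g [f0 fh fZ] [g0 gh gZ]; split; first exact: C0M.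
  + by move=> x y xy /=; rewrite (fh _ _ xy) (gh _ _ xy).
  + by move=> x Zx /=; rewrite fZ// mul0r.
- move=> f Af; split.
  + apply: C0_closed; apply: closure_subset Af.
    by move=> g [].
  + move=> x y xy; apply/eqP; rewrite -subr_eq0 -normr_le0; apply/ler_addgt0Pl => e e0.
    have e20 : 0 < e / 2 by rewrite divr_gt0.
    have [g [_ gh _] fg] := uniform_closureP Af e20.
    have := fg x; have := fg y; rewrite (gh _ _ xy) addr0 !ltr_norml ler_norml; lra.
  + move=> x Zx; apply/eqP; rewrite -normr_le0; apply/ler_addgt0Pl => e e0.
    have [g [_ _ gZ] fg] := uniform_closureP Af e0.
    by have := fg x; rewrite (gZ _ Zx) subr0 addr0 => /ltW.
- by move=> cX; split=> //; [exact: C01|rewrite XZ].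
Qed.

Lemma gen_subalgebra_fiber h Z : (compact [set: X] -> Z = set0) ->
  Z `<=` [set 0] -> C0 h -> gen_subalgebra h `<=` fiber_algebra h Z.
Proof.
move=> XZ Z0 h0; apply: smallest_sub; first exact: fiber_algebra_closed.
by move=> _ ->; split=> // x /Z0.
Qed.

Lemma Cc_C0 f : Cc f -> C0 f.
Proof.
move=> [cf sf]; apply: C0_sub_compact => // e e0; exists (closure [set x | f x != 0]) => //.
by move=> x /= ef; apply: subset_closure => /=; rewrite -normr_gt0 (lt_le_trans e0).
Qed.

Lemma Cc_sub h f : Cc h -> continuous f -> (forall x, h x = 0 -> f x = 0) -> Cc f.
Proof.
move=> [ch sh] cf hf; split=> //; apply: subclosed_compact sh _; first exact: closed_closure.
by apply: closure_subset => x /=; apply: contra => /eqP/hf ->.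
Qed.

Lemma Cc_compact f : compact [set: X] -> continuous f -> Cc f.
Proof.
move=> cX cf; split=> //; apply: subclosed_compact cX _ => //; exact: closed_closure.
Qed.

(** On a compact space every continuous function has compact support. Otherwise elements of the
    algebra vanish wherever [h] does, so their supports lie in that of [h]. *)
Lemma Cc_gen_subalgebra h : Cc h -> gen_subalgebra h `<=` Cc.
Proof.
move=> hc f; pose Z : set R := [set t | t = 0 /\ ~ compact [set: X]].
have /[apply] : gen_subalgebra h `<=` fiber_algebra h Z.
  apply: gen_subalgebra_fiber; last exact: Cc_C0.
    by move=> cX; apply/seteqP; split=> // t [].
  by move=> t [].
move=> [f0 _ fZ]; have [cX|ncX] := pselect (compact [set: X]).
  exact: Cc_compact f0.1.
by apply: (Cc_sub hc f0.1) => x hx; exact: fZ.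
Qed.

End FunctionAlgebras.

(** * Topological measures *)

Section TopologicalMeasure.
Context {R : realType} {X : topologicalType}.
Variable mu : set X -> \bar R.
Hypothesis hmu : topological_measure mu.

Lemma tm_le (A U : set X) : compact_or_open A -> open U -> A `<=` U ->
  mu A <= mu U.
Proof.
have cle K V : compact K -> open V -> K `<=` V -> mu K <= mu V.
  by move=> cK oV KV; rewrite (tm_inner hmu oV); apply: ereal_sup_ubound; exists K.
case=> [cA|oA] oU AU; first exact: cle.
rewrite (tm_inner hmu oA); apply: ge_ereal_sup => _ [K [cK KA] <-].
exact/cle/(subset_trans KA).
Qed.

Lemma tm_open_ge0 (U : set X) : open U -> 0 <= mu U.
Proof. by move=> oU; apply: (tm_ge0 hmu); left. Qed.

Lemma tm_finite_open : exists2 U, open U & mu U < +oo.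
Proof.
have [A [oclA Aoo]] := tm_proper hmu.
have {}Aoo : mu A < +oo by rewrite ltey; exact/eqP.
case: oclA => [oA|cA]; first by exists A.
by move: Aoo; rewrite (tm_outer hmu cA) => /ereal_inf_lt[_ [U [oU _] <-] ?]; exists U.
Qed.

Lemma tm_set0 : mu set0 = 0.
Proof.
have [U oU Uoo] := tm_finite_open.
have Ufin : mu U \is a fin_num by rewrite ge0_fin_numE// tm_open_ge0.
have o0 : open (set0 : set X) by exact: open0.
have : mu (U `|` set0) = mu U + mu set0.
  by apply: (tm_add hmu); rewrite ?setI0 ?setU0//; right.
rewrite setU0 -[X in X = _]adde0 => /esym /eqP.
have f0 : mu set0 \is a fin_num.
  by rewrite ge0_fin_numE ?tm_open_ge0// (le_lt_trans _ Uoo)// tm_le//; right.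
by rewrite -(fineK Ufin) -(fineK f0) -!EFinD eqe => /eqP/addrI ->.
Qed.

Lemma tm_fin_num (A U : set X) : 0 <= mu A -> compact_or_open A -> open U ->
  A `<=` U -> mu U < +oo -> mu A \is a fin_num.
Proof.
by move=> A0 cA oU AU Uoo; rewrite ge0_fin_numE// (le_lt_trans _ Uoo)// tm_le.
Qed.

(** [V] is approximated from inside by compact sets [L]; additivity applies to the disjoint compact
    sets [K] and [L], whose union lies in [W]. *)
Lemma tm_superadd (K V W : set X) : hausdorff_space X ->
  compact K -> open V -> open W -> K `&` V = set0 ->
  K `|` V `<=` W -> mu W < +oo -> mu K + mu V <= mu W.
Proof.
move=> hX cK oV oW KV KVW Woo.
have Kfin : mu K \is a fin_num.
  apply: (@tm_fin_num _ W) => //; [|by left|by move=> x ?; apply: KVW; left].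
  by apply: (tm_ge0 hmu); right; exact: compact_closed.
rewrite addeC -leeBrDr// (tm_inner hmu oV); apply: ge_ereal_sup => _ [L [cL LV] <-].
rewrite leeBrDr// addeC -(tm_add hmu); [|by rewrite -subset0 -KV; apply: setIS|by left..|].
  by apply: tm_le => //; [left; exact: compactU|move=> x [Kx|/LV Vx]; apply: KVW; [left|right]].
by left; exact: compactU.
Qed.

Lemma tm_bigsetU (A : (set X)^nat) (n : nat) : (forall i, open (A i)) ->
  trivIset setT A -> mu (\big[setU/set0]_(i < n) A i) = \sum_(i < n) mu (A i).
Proof.
move=> oA tA.
have ob k : open (\big[setU/set0]_(i < k) A i).
  by rewrite -bigcup_mkord; apply: bigcup_open.
elim: n => [|n ih]; first by rewrite !big_ord0 tm_set0.
rewrite !big_ord_recr/= -ih; apply: (tm_add hmu).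
- rewrite -bigcup_mkord setI_bigcupl bigcup0// => i /= ni.
  by apply: ((trivIsetP.1 tA) _ _ Logic.I Logic.I); rewrite ltn_eqF.
- by right; exact: ob.
- by right; exact: oA.
- by right; apply: openU; [exact: ob|exact: oA].
Qed.

End TopologicalMeasure.

(** * The Stieltjes measure of a function *)

(* [Q] is [setT] in case (A) and the complement of 0 in case (B). *)
Section StieltjesRepresentation.
Context {R : realType} {X : topologicalType}.
Variable mu : set X -> \bar R.
Hypotheses (hmu : topological_measure mu) (hX : hausdorff_space X).
Variables (h : X -> R) (Q : set R).
Hypotheses (hC0 : C0 h) (oQ : open Q) (Q0 : forall t, t != 0%R -> Q t).
Hypothesis Qfin : mu (h @^-1` Q) < +oo.

(** The value that the Stieltjes measure is to take on an open [U]. *)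
Let nu (U : set R) := mu (h @^-1` (U `&` Q)).
Let F (a : R) : R := fine (nu `]a, +oo[).
Hypothesis tF : is_tail F.

Let oh (U : set R) : open U -> open (h @^-1` U).
Proof. by move=> oU; apply: open_comp => // x _; exact: hC0.1. Qed.

Let ohQ (U : set R) : open U -> open (h @^-1` (U `&` Q)).
Proof. by move=> oU; apply/oh/openI. Qed.

Let nu_fin (U : set R) : open U -> nu U \is a fin_num.
Proof.
move=> oU; apply: (tm_fin_num hmu _ _ (oh oQ)) => //; last by move=> x [].
- by apply: (tm_open_ge0 hmu); exact: ohQ.
- by right; exact: ohQ.
Qed.

Let nu_le (U V : set R) : open U -> open V -> U `<=` V -> nu U <= nu V.
Proof.
move=> oU oV UV; apply: (tm_le hmu) => //; [by right; exact: ohQ|exact: ohQ|].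
by move=> x [/UV].
Qed.

Let compact_ge (c : R) : (0 < c)%R -> compact (h @^-1` `[c, +oo[).
Proof.
move=> c0; apply: subclosed_compact (hC0.2 _ c0) _ => /=.
  by apply: closed_comp => [x _|]; [exact: hC0.1|exact: interval_closed].
by move=> x /=; rewrite in_itv/= andbT => /le_trans; apply; exact: ler_norm.
Qed.

Let compact_le (c : R) : (c < 0)%R -> compact (h @^-1` `]-oo, c]).
Proof.
move=> c0; have c0' : (0 < - c)%R by rewrite oppr_gt0.
apply: subclosed_compact (hC0.2 _ c0') _ => /=.
  by apply: closed_comp => [x _|]; [exact: hC0.1|exact: interval_closed].
move=> x /=; rewrite in_itv/= => hc; rewrite ler0_norm ?lerN2//.
by apply: le_trans hc _; exact: ltW.
Qed.

Let mu_compact_le (D U : set R) : compact (h @^-1` D) -> open U ->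
  D `<=` U `&` Q -> mu (h @^-1` D) <= nu U.
Proof.
by move=> cD oU DU; apply: (tm_le hmu); [left|exact: ohQ|move=> x /DU].
Qed.

Let nu_split (D U V : set R) : compact (h @^-1` D) -> open U -> open V ->
  D `&` U = set0 -> V `&` Q = D `|` (U `&` Q) ->
  nu V = mu (h @^-1` D) + nu U.
Proof.
move=> cD oU oV DU VE; rewrite /nu VE preimage_setU (tm_add hmu)//.
- by rewrite -preimage_setI setIA DU set0I preimage_set0.
- by left.
- by right; exact: ohQ.
- by right; rewrite -preimage_setU -VE; exact: ohQ.
Qed.

Let Qge (c t : R) : (0 < c)%R -> (c <= t)%R -> Q t.
Proof. by move=> c0 ct; apply: Q0; rewrite gt_eqF// (lt_le_trans c0). Qed.

Let Qle (c t : R) : (c < 0)%R -> (t <= c)%R -> Q t.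
Proof. by move=> c0 ct; apply: Q0; rewrite lt_eqF// (le_lt_trans ct). Qed.

(** For [c > 0] the set [h >= c] is compact and splits off from the tail beyond [a], leaving
    [a < h < c]; the two pieces then enlarge to [h > b] and [a < h < d]. *)
Let tail_le_pos (a b c d : R) : (a < b)%R -> (b < c)%R -> (c < d)%R -> (0 < c)%R ->
  nu `]a, +oo[ <= nu `]a, d[ + nu `]b, +oo[.
Proof.
move=> ab bc cd c0; have ac := lt_trans ab bc.
rewrite (@nu_split `[c, +oo[ `]a, c[) //; first last.
- apply/seteqP; split=> [x []|x [|[]]]/=; rewrite !in_itv/= !andbT.
  + by move=> -> Qx; have [cx|xc] := leP c x; [left|right].
  + by move=> cx; split; [exact: lt_le_trans cx|exact: Qge cx].
  + by move=> /andP[].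
- by apply/seteqP; split=> // x []/=; rewrite !in_itv/= andbT leNgt => /negP xc /andP[].
- exact: compact_ge.
rewrite addeC; apply: leeD.
  apply: nu_le => // x /=; rewrite !in_itv/= => /andP[-> /=] /lt_trans; exact.
apply: mu_compact_le => //; first exact: compact_ge.
move=> x /=; rewrite !in_itv/= !andbT => cx; split; last exact: Qge cx.
exact: lt_le_trans cx.
Qed.

(** For [c < 0] it is [h <= c] that is compact, so the total mass is cut instead, at [a] and at [c].
    The part [h <= c] lies in [h < d], which splits into [h <= a] and [a < h < d]; the finite mass
    of [h <= a] cancels. *)
Let tail_le_neg (a b c d : R) : (a < b)%R -> (b < c)%R -> (c < d)%R -> (c < 0)%R ->
  nu `]a, +oo[ <= nu `]a, d[ + nu `]b, +oo[.
Proof.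
move=> ab bc cd c0; have ac := lt_trans ab bc; have a0 := lt_trans ac c0.
have split_le (s : R) : (s < 0)%R ->
    nu setT = mu (h @^-1` `]-oo, s]) + nu `]s, +oo[.
  move=> s0; apply: nu_split => //; [exact: compact_le|exact: openT| |].
  - by apply/seteqP; split=> // x []/=; rewrite !in_itv/= andbT leNgt => /negP.
  - apply/seteqP; split=> [x []|x [|[]]]//=; rewrite !in_itv/= ?andbT.
    + by move=> _ Qx; have [xs|sx] := leP x s; [left|right].
    + by move=> xs; split => //; exact: Qle xs.
have muaE : nu `]-oo, d[ = mu (h @^-1` `]-oo, a]) + nu `]a, d[.
  apply: nu_split => //; first exact: compact_le.
  - by apply/seteqP; split=> // x []/=; rewrite !in_itv/= leNgt => /negP ax /andP[].
  - apply/seteqP; split=> [x []|x [|[]]]//=; rewrite !in_itv/=.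
    + by move=> -> Qx; have [xs|sx] := leP x a; [left|right].
    + by move=> xa; split; [rewrite (le_lt_trans xa)// (lt_trans ac)|exact: Qle xa].
    + by move=> /andP[].
have le1 : mu (h @^-1` `]-oo, c]) <= nu `]-oo, d[.
  apply: mu_compact_le => //; first exact: compact_le.
  by move=> x /=; rewrite !in_itv/= => xc; split; [exact: le_lt_trans cd|exact: Qle xc].
have le2 : nu `]c, +oo[ <= nu `]b, +oo[.
  by apply: nu_le => // x /=; rewrite !in_itv/= !andbT; exact: lt_trans.
have mafin : mu (h @^-1` `]-oo, a]) \is a fin_num.
  have := nu_fin openT; rewrite (split_le _ a0) fin_numD => /andP[//].
rewrite -(@leeD2lE _ (mu (h @^-1` `]-oo, a])))// addeA -muaE -split_le//.
by rewrite (split_le _ c0) leeD.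
Qed.

(* [mu] is not subadditive: a level [c != 0] between [b] and [d] is needed because
   only [h >= c] with [c > 0] and [h <= c] with [c < 0] are compact. *)
Let tail_le (a b d : R) : (a < b)%R -> (b < d)%R ->
  nu `]a, +oo[ <= nu `]a, d[ + nu `]b, +oo[.
Proof.
move=> ab bd.
have [c /andP[bc cd] c0] : exists2 c, (b < c < d)%R & c != 0%R.
  (* The midpoint of [b] and [d] serves unless it is 0; then [b = - d], and [(d - b) / 4] is
     [d / 2]. *)
  have [bd0|] := eqVneq ((b + d) / 2)%R 0%R; last first.
    by exists ((b + d) / 2)%R => //; rewrite !midf_lt.
  by exists ((d - b) / 4)%R; lra.
move: c0; rewrite neq_lt => /orP[c0|c0].
  exact: (tail_le_neg ab bc cd c0).
exact: (tail_le_pos ab bc cd c0).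
Qed.

Let m := stieltjes F.

(** The interval is exhausted by []a, b]] with [b < d], whose measure is [F a - F b]; [tail_le]
    bounds this difference. *)
Let itvoo_ge (a d : R) : (a < d)%R -> m `]a, d[%classic <= nu `]a, d[.
Proof.
move=> ad.
have mcvg : m `]a, (d - n.+1%:R^-1)%R]%classic @[n --> \oo] --> m `]a, d[%classic.
  rewrite itv_bnd_open_bigcup.
  apply: (@nondecreasing_cvg_mu _ _ _ m (fun n => `]a, (d - n.+1%:R^-1)%R]%classic)).
  - by move=> n; exact: measurable_itv.
  - by apply: bigcup_measurable => n _; exact: measurable_itv.
  - apply/nondecreasing_seqP => n; apply/subsetPset => x /=.
    rewrite !in_itv/= => /andP[-> /=] /le_trans; apply.
    by rewrite lerD2l lerN2 lef_pV2 ?posrE// ler_nat.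
rewrite -(cvg_lim _ mcvg)//; apply: lime_le; first by apply/cvg_ex; eexists; exact: mcvg.
apply: nearW => n; set b := (d - _)%R.
have bd : (b < d)%R by rewrite ltrBlDr ltrDl.
have [ba|ab] := leP b a.
  rewrite set_itv_ge ?bnd_simp -?leNgt// measure0.
  by apply: (tm_open_ge0 hmu); exact: ohQ.
rewrite stieltjesE// -(fineK (nu_fin (interval_open _ _)))//.
rewrite lee_fin lerBlDr -lee_fin EFinD !fineK//; first exact: tail_le.
all: by apply: nu_fin; exact: interval_open.
Qed.

(** On a compact [K] inside the preimage, [h] stays below some [b < d]. Superadditivity for [K] and
    the tail beyond [b] bounds [mu K] by [F a - F b], the measure of []a, b]]. *)
Let itvoo_le (a d : R) : (a < d)%R -> nu `]a, d[ <= m `]a, d[%classic.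
Proof.
move=> ad; rewrite [nu _](tm_inner hmu)//; last exact: ohQ.
apply: ge_ereal_sup => _ [K [cK Kad] <-].
have nearK : \forall b \near d^'-, K `<=` h @^-1` `]-oo, b[.
  move: cK => /compact_near_coveringP; apply => x /Kad [].
  rewrite /= in_itv/= => /andP[_ xd] _.
  exists (h @^-1` `]-oo, ((h x + d) / 2)%R[, [set c | ((h x + d) / 2 < c)%R]) => [|[y c]/= []].
    split=> /=; last by apply: nbhs_left_gt; rewrite midf_lt.
    apply: open_nbhs_nbhs; split; first exact: oh.
    by rewrite /= in_itv/= midf_lt.
  by rewrite !in_itv/=; exact: lt_trans.
have [b [[ab bd] Kb]] : exists b, ((a < b)%R /\ (b < d)%R) /\ K `<=` h @^-1` `]-oo, b[.
  near ((d : R)^'-) => b; exists b; split; first split.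
  - by near: b; exact: nbhs_left_gt.
  - by near: b; exact: nbhs_left_lt.
  - by near: b.
apply: (@le_trans _ _ (m `]a, b]%classic)); last first.
  apply: le_measure; rewrite ?inE; [exact: measurable_itv|exact: measurable_itv|].
  by move=> x /=; rewrite !in_itv/= => /andP[-> /=] /le_lt_trans; apply.
rewrite stieltjesE// EFinB !fineK; last 2 first.
- by apply: nu_fin; exact: interval_open.
- by apply: nu_fin; exact: interval_open.
rewrite leeBrDr; last by apply: nu_fin; exact: interval_open.
apply: (tm_superadd hmu) => //; [exact: ohQ|exact: ohQ| | |].
- apply/seteqP; split=> // x [/Kb + []]/=.
  by rewrite !in_itv/= andbT => /lt_trans/[apply]; rewrite ltxx.
- move=> x [/Kad[]|[]]/=; rewrite !in_itv/= !andbT; first by move=> /andP[].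
  by move=> bx Qx; split => //; exact: lt_trans bx.
- by rewrite -ge0_fin_numE; [exact: nu_fin|apply: (tm_open_ge0 hmu); exact: ohQ].
Unshelve. all: by end_near. Qed.

Let itvooE (a d : R) : m `]a, d[%classic = nu `]a, d[.
Proof.
have [ad|da] := ltP a d.
  by apply/eqP; rewrite eq_le itvoo_ge// itvoo_le.
have -> : `]a, d[%classic = set0 :> set R by rewrite set_itv_ge// bnd_simp -leNgt.
by rewrite measure0 /nu set0I preimage_set0 (tm_set0 hmu).
Qed.

(** Additivity on open sets settles finite unions; a compact subset of the infinite union already
    lies in a finite one, so inner regularity gives the limit. *)
Let nu_bigcup (I : (set R)^nat) : (forall i, open (I i)) -> trivIset setT I ->
  nu (\bigcup_i I i) = \sum_(0 <= i <oo) nu (I i).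
Proof.
move=> oI tI.
pose A i := h @^-1` (I i `&` Q).
have tA : trivIset setT A.
  apply/trivIsetP => i j _ _ ij; rewrite -preimage_setI setIACA setIid.
  by move/trivIsetP : tI => ->; rewrite ?set0I ?preimage_set0.
have sumE n : \sum_(0 <= i < n) nu (I i) = nu (\bigcup_(i in `I_n) I i).
  rewrite big_mkord -[LHS](@tm_bigsetU _ _ _ hmu A)//; last by move=> i; exact: ohQ.
  by rewrite -bigcup_mkord /nu setI_bigcupl preimage_bigcup.
have oU (P : set nat) : open (\bigcup_(i in P) I i) by exact: bigcup_open.
apply/eqP; rewrite eq_le; apply/andP; split; last first.
  apply: lime_le; first by apply: is_cvg_nneseries => *; exact/(tm_open_ge0 hmu)/ohQ.
  by apply: nearW => n; rewrite sumE; apply: nu_le => // x [i _ Ix]; exists i.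
rewrite [nu _](tm_inner hmu); last exact: ohQ.
apply: ge_ereal_sup => _ [K [cK KI] <-].
have nearK : \forall n \near \oo, K `<=` \bigcup_(i in `I_n) A i.
  move: cK => /compact_near_coveringP; apply => x /KI[[i _ Iix] Qx].
  exists (A i, [set n | (i < n)%N]) => [|[y n]/= [Ay ni]]; last by exists i.
  split=> /=; last by exists i.+1.
  by apply: open_nbhs_nbhs; split; [exact: ohQ|split].
have [n _ /(_ n (leqnn n)) KD] := nearK.
apply: (@le_trans _ _ (\sum_(0 <= i < n) nu (I i))); last first.
  by apply: nneseries_lim_ge => *; exact/(tm_open_ge0 hmu)/ohQ.
rewrite sumE; apply: (tm_le hmu); [by left|exact: ohQ|].
by move=> x /KD[i /= iD [Iix Qx]]; split => //; exists i.
Qed.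

(** An open set is a disjoint union of open intervals; boundedness makes each of them some []a, d[],
    where [itvooE] applies. *)
Let open_bounded (U : set R) (M : R) : open U -> U `<=` `](- M)%R, M[ ->
  m U = nu U.
Proof.
move=> oU UM; pose I := open_disjoint_itv oU.
have oI i : open (I i) by exact: open_disjoint_itv_open.
have tI : trivIset setT I by exact: open_disjoint_itv_trivIset.
have UE : U = \bigcup_i I i by exact: open_disjoint_itv_bigcup.
rewrite UE nu_bigcup// measure_bigcup//; last first.
  by move=> i _; exact: open_measurable.
have IM i : I i `<=` `](- M)%R, M[ by apply: subset_trans UM; rewrite UE; exact: bigcup_sup.
rewrite (@eq_eseriesl _ _ xpredT); last by move=> i; exact: in_setT.
apply: eq_eseriesr => i _.
have <- : (I i)° = I i by apply/interior_id; exact: oI.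
rewrite interval_bounded_interior ?itvooE//.
- exact: open_disjoint_itv_is_interval.
- by exists (- M)%R => x /IM/=; rewrite in_itv/= => /andP[/ltW].
- by exists M => x /IM/=; rewrite in_itv/= => /andP[_ /ltW].
Qed.

(** Truncation to []-n, n[] makes [U] bounded; since [h] is bounded, the truncated set has the same
    preimage as [U] once [n] is large. *)
Lemma stieltjes_open (U : set R) : open U -> stieltjes F U = mu (h @^-1` (U `&` Q)).
Proof.
move=> oU; rewrite -/m -/(nu U).
have [M hM] := C0_bounded hC0.
pose V n := U `&` `](- n%:R)%R, n%:R%R[.
have oV n : open (V n) by apply: openI => //; exact: interval_open.
have UV : U = \bigcup_n V n.
  apply/seteqP; split=> [x Ux|x [n _ []]//].
  exists (Num.bound `|x|) => //; split=> //=; rewrite in_itv/= -ltr_norml.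
  by rewrite archi_boundP.
have mcvg : m (V n) @[n --> \oo] --> m U.
  rewrite UV; apply: (@nondecreasing_cvg_mu _ _ _ m V).
  - by move=> n; exact: open_measurable.
  - by rewrite -UV; exact: open_measurable.
  - apply/nondecreasing_seqP => n; apply/subsetPset => x [Ux]/=.
    rewrite !in_itv/= -!ltr_norml => xn; split => //=; rewrite in_itv/= -ltr_norml.
    by apply: lt_le_trans xn _; rewrite ler_nat.
apply: (@cvg_unique _ _ (m (V n) @[n --> \oo]) _ _ _ mcvg) => //.
apply: cvg_near_cst; exists (Num.bound M) => // n /= Mn.
rewrite (@open_bounded _ n%:R)//; last by move=> x [].
congr mu; apply/seteqP; split=> [x [[]]//|x [Ux Qx]].
split=> //; split=> //=.
rewrite in_itv/= -ltr_norml; apply: le_lt_trans (hM x) _.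
apply: lt_le_trans (_ : (Num.bound M)%:R <= _)%R; last by rewrite ler_nat.
by rewrite archi_boundP// (le_trans _ (hM x)).
Qed.

End StieltjesRepresentation.

(** * Measures that represent a function, and images of closed sets *)

Section Representation.
Local Open Scope ring_scope.
Local Open Scope ereal_scope.
Context {R : realType} {X : topologicalType}.
Variable mu : set X -> \bar R.
Hypotheses (hmu : topological_measure mu) (hX : hausdorff_space X).
Implicit Types (m : {measure set (measurableTypeR R) -> \bar R}) (f h : X -> R).

(** [Z] collects the values about which nothing is claimed: [set0] asks for agreement on all open
    sets, [[set 0]] only off 0. *)
Definition represents m (Z : set R) f :=
  forall U : set R, open U -> U `&` Z = set0 -> m U = mu (f @^-1` U).

Lemma stieltjes_tailA f : C0 f -> mu [set: X] < +oo ->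
  represents (stieltjes (tailA mu f)) set0 f /\
  stieltjes (tailA mu f) setT = mu [set: X].
Proof.
move=> f0 muoo.
have tE : tailA mu f = fun a => fine (mu (f @^-1` (`]a, +oo[ `&` setT))).
  by apply/funext => a; rewrite setIT.
have SE U : open U -> stieltjes (tailA mu f) U = mu (f @^-1` U).
  move=> oU; rewrite tE (stieltjes_open hmu hX f0) ?setIT//; first exact: openT.
  by rewrite -tE; exact: is_tailA.
by split=> [U oU _|]; rewrite SE//; exact: openT.
Qed.

(** Outer regularity encloses the compact support in an open set of finite measure, and monotonicity
    applies there. *)
Lemma Cc_support_finite f : Cc f -> compact_finite mu ->
  mu (f @^-1` (~` [set 0%R])) < +oo.
Proof.
move=> [cf sf] fin.
have : mu (closure [set x | f x != 0%R]) < +oo by exact: fin.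
rewrite (tm_outer hmu (@closed_closure _ _)) => /ereal_inf_lt[_ [V [oV sV] <-]].
apply: le_lt_trans; apply: (tm_le hmu) => //.
  right; apply: open_comp => [x _|]; first exact: cf.
  by apply: closed_openC; exact: closed_eq.
by move=> x /eqP fx0; exact/sV/subset_closure.
Qed.

Lemma stieltjes_tailB f : Cc f -> compact_finite mu ->
  represents (stieltjes (tailB mu f)) [set 0%R] f /\
  stieltjes (tailB mu f) setT < +oo.
Proof.
move=> fc fin.
have SE U : open U ->
    stieltjes (tailB mu f) U = mu (f @^-1` (U `&` ~` [set 0%R])).
  move=> oU; apply: (stieltjes_open hmu hX (Cc_C0 fc)) => //.
  - by apply: closed_openC; exact: closed_eq.
  - by move=> t /eqP.
  - exact: Cc_support_finite.
  - exact: is_tailB.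
split=> [U oU U0|]; rewrite SE//.
- by congr mu; congr (_ @^-1` _); apply/setIidPl/disjoints_subset.
- by rewrite setTI; exact: Cc_support_finite.
- exact: openT.
Qed.

(** The integrand vanishes at 0, so only the restrictions to the complement of 0 count. That of [m1]
    is finite, and the two agree on the rays []x, +oo[], an intersection-stable generating class,
    hence on all Borel sets. *)
Lemma eq_Rintegral_off0 m1 m2 : m1 setT < +oo ->
  (forall U : set R, open U -> U `&` [set 0%R] = set0 -> m1 U = m2 U) ->
  (\int[m1]_(t in setT) t = \int[m2]_(t in setT) t)%R.
Proof.
move=> m1oo m12.
have mD : measurable (~` [set 0%R] : set (measurableTypeR R)).
  by apply: measurableC; exact: measurable_set1.
have oD : open (~` [set 0%R] : set R) by apply: closed_openC; exact: closed_eq.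
have off0 m : \int[m]_(t in setT) t%:E = \int[m]_(t in ~` [set 0%R]) t%:E.
  rewrite [RHS]integral_mkcond; apply: eq_integral => t _.
  by rewrite patchE; case: ifPn => //; rewrite notin_setE/= => /contrapT ->.
rewrite /Rintegral !off0; congr fine; apply: eq_measure_integral => A mA AD.
have restrE m : m A = mrestr m mD A by rewrite /mrestr; congr (m _); apply/esym/setIidPl.
rewrite (restrE m1) (restrE m2).
pose r m : {measure set (measurableTypeR R) -> \bar R} := mrestr m mD.
rewrite -/(r m1 A) -/(r m2 A).
apply: (@measure_unique _ R (measurableTypeR R) (@RGenOInfty.G R)
  (fun k => `](- k%:R)%R, +oo[%classic)) => //.
- exact: RGenOInfty.measurableE.
- move=> _ _ [x ->] [y ->]; exists (Num.max x y).
  by apply/seteqP; split=> t; rewrite /= !in_itv/= !andbT gt_max => /andP.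
- by move=> i; eexists; reflexivity.
- apply/seteqP; split=> // t _; exists (Num.bound `|t|) => //=.
  rewrite in_itv/= andbT ltrNl; apply: le_lt_trans (archi_boundP (normr_ge0 t)).
  by rewrite -normrN ler_norm.
- move=> _ [x ->]; rewrite /= /mrestr; apply: m12.
    by apply: openI => //; exact: interval_open.
  by rewrite -setIA setICl setI0.
- move=> k; rewrite /= /mrestr; apply: le_lt_trans m1oo; apply: le_measure; rewrite ?inE//.
  by apply: measurableI => //; exact: measurable_itv.
Qed.

(** Vanishing at infinity makes [f] proper off 0: near a nonzero [t] only points where the absolute
    value of [f] is at least half that of [t] matter, and they form a compact set. If [X] is
    compact, the image of [D] is itself compact. *)
Lemma closed_image_setU f (D : set X) (Z : set R) : C0 f -> closed D ->
  Z `<=` [set 0%R] -> compact [set: X] \/ Z 0%R -> closed (f @` D `|` Z).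
Proof.
move=> [cf f0] cD Z0 [cX|Z00].
  apply: closedU.
    apply: compact_closed; first exact: Rhausdorff.
    apply: continuous_compact; first exact: continuous_subspaceT.
    exact: subclosed_compact cX _.
  have /subset_set1[->|->] := Z0; [exact: closed0|exact: closed_eq].
move=> t ft; have [->|t0] := eqVneq t 0%R; [by right|left].
pose e := (`|t| / 2)%R.
have e0 : (0 < e)%R by rewrite divr_gt0// normr_gt0.
have : closed (f @` (D `&` [set x | (e <= `|f x|)%R])).
  apply: compact_closed; first exact: Rhausdorff.
  apply: continuous_compact; first exact: continuous_subspaceT.
  apply: subclosed_compact (f0 _ e0) _; last by move=> x [].
  by apply: closedI => //; apply: compact_closed => //; exact: f0.
suff /[swap]/[apply] : closure (f @` (D `&` [set x | (e <= `|f x|)%R])) t.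
  by case=> x [Dx _] <-; exists x.
move=> B Bt.
have : nbhs t (B `&` ball t e) by apply: filterI => //; exact: nbhsx_ballx.
move=> /ft[s [fDs [Bs ts]]].
have es : (e <= `|s|)%R.
  have := ler_normD (t - s)%R s; rewrite subrK; move: ts; rewrite /ball/= /e; lra.
exists s; split => //.
case: fDs => [[x Dx xs]|/Z0 s0]; first by exists x => //; split => //=; rewrite xs.
by move: es; rewrite s0 normr0 leNgt e0.
Qed.

Lemma measurable_image f (D : set X) : C0 f -> closed D ->
  measurable (f @` D : set (measurableTypeR R)).
Proof.
move=> f0 cD.
have m0 : measurable (f @` D `|` [set 0%R] : set (measurableTypeR R)).
  by apply: closed_measurable; apply: closed_image_setU => //; right.
have [D0|D0] := pselect ((f @` D) 0%R).
  by rewrite (_ : f @` D = f @` D `|` [set 0%R])//; apply/esym/setUidPl => t ->.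
rewrite (_ : f @` D = (f @` D `|` [set 0%R]) `\ 0%R); last first.
  apply/seteqP; split=> [t ft|t [[]//]].
  by split; [left|move=> t0; apply: D0; rewrite -t0].
by apply: measurableD => //; exact: measurable_set1.
Qed.

End Representation.

(** * Factorization through a generator *)

Section Factor.
Local Open Scope ring_scope.
Context {R : realType} {X : topologicalType}.
Hypothesis hX : hausdorff_space X.
Implicit Types (f g h : X -> R) (Z : set R).

(* The function [phi] with [f = phi \o h], extended by 0 off the range of [h]. *)
Definition factor h f (t : R) : R :=
  if pselect (exists x, h x = t) is left ht then f (projT1 (cid ht)) else 0.

Lemma factorE h Z f x : fiber_algebra h Z f -> factor h f (h x) = f x.
Proof.
move=> [_ fh _]; rewrite /factor; case: pselect => [ht|]; last by case; exists x.
by apply: fh; exact: (projT2 (cid ht)).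
Qed.

Lemma factor_out h f t : ~ range h t -> factor h f t = 0.
Proof.
rewrite /factor; case: pselect => // ht ht'; exfalso; apply: ht'.
by have [x hx] := ht; exists x.
Qed.

Lemma factor_all h f (P : R -> Prop) t : P 0 -> (forall x, P (f x)) -> P (factor h f t).
Proof. by move=> P0 Pf; rewrite /factor; case: pselect. Qed.

Lemma factorD h f g t : factor h (f \+ g) t = factor h f t + factor h g t.
Proof. by rewrite /factor; case: pselect => //=; rewrite addr0. Qed.

Lemma factorZ h a f t : factor h (a \*o f) t = a * factor h f t.
Proof. by rewrite /factor; case: pselect => //=; rewrite mulr0. Qed.

(** The second set accounts for the default value 0 taken off the range of [h]. *)
Lemma preimage_factor h Z f (C : set R) : fiber_algebra h Z f ->
  factor h f @^-1` C = h @` (f @^-1` C) `|` [set t | C 0 /\ ~ range h t].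
Proof.
move=> hf; apply/seteqP; split=> t /=.
  have [[x _ <-]|ht] := pselect (range h t).
    by rewrite (factorE _ hf) => Cfx; left; exists x.
  by rewrite (factor_out _ ht) => C0'; right.
by move=> [[x Cfx <-]|[C0' ht]]; rewrite ?(factorE _ hf)// factor_out.
Qed.

(** Preimages of closed rays are images under [h] of closed sets, possibly joined with the
    complement of the range, and all of these are Borel. *)
Lemma measurable_factor h Z f : C0 h -> fiber_algebra h Z f ->
  measurable_fun setT (factor h f : measurableTypeR R -> measurableTypeR R).
Proof.
move=> h0 hf; have [[cf _] _ _] := hf.
apply: (measurability _ (RGenCInfty.measurableE R)) => _ [_ [c ->] <-].
rewrite setTI (preimage_factor _ hf); apply: measurableU.
  apply: (measurable_image hX h0); apply: closed_comp; last exact: interval_closed.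
  by move=> x _; exact: cf.
have [c0|c0] := pselect (`[c, +oo[%classic 0).
  rewrite (_ : mkset _ = ~` range h); last by apply/seteqP; split=> t // [].
  by apply: measurableC; apply: (measurable_image hX h0); exact: closedT.
rewrite (_ : mkset _ = set0)//.
by apply/seteqP; split=> t // [].
Qed.

Local Open Scope ereal_scope.
Variable mu : set X -> \bar R.
Hypothesis hmu : topological_measure mu.
Variable m : {measure set (measurableTypeR R) -> \bar R}.
Variables (h : X -> R) (Z : set R).
Hypotheses (h0 : C0 h) (mh : represents mu m Z h) (moo : m setT < +oo).
Hypotheses (Z0 : Z `<=` [set 0%R]) (XZ : compact [set: X] \/ Z 0%R).

(** [V] consists of the values outside [Z] that [h] does not take where [f] misses [U]. As [f]
    vanishes wherever [h] has a value in [Z], and 0 is not in [U], the preimage of [V] under [h] is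
    that of [U] under [f]. *)
Lemma measure_factor f (U : set R) : fiber_algebra h Z f -> open U ->
  U `&` [set 0%R] = set0 -> m (factor h f @^-1` U) = mu (f @^-1` U).
Proof.
move=> hf oU U0; have [[cf _] fh fZ] := hf.
have nU0 : ~ U 0%R by move=> U00; have : (U `&` [set 0%R]) 0%R by []; rewrite U0.
pose V := ~` (h @` (f @^-1` (~` U)) `|` Z).
pose W := ~` (range h `|` Z).
have oV : open V.
  apply: closed_openC; apply: closed_image_setU => //.
  by apply: closed_comp => [x _|]; [exact: cf|exact: open_closedC].
have oW : open W by apply: closed_openC; apply: closed_image_setU => //; exact: closedT.
(* [factor h f @^-1` U] need not be open; it differs from the open set [V] by a
   subset of the null set [W]. *)
have <- : m V = mu (f @^-1` U).
  rewrite mh//; last by apply/seteqP; split=> // t [/not_orP[]].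
  congr mu; apply/seteqP; split=> [x /not_orP[nfx _]|x Ufx].
    by apply: contrapT => nUfx; apply: nfx; exists x.
  apply/not_orP; split; first by move=> [y nUy /fh]; move=> yx; apply: nUy; rewrite /= yx.
  by move=> /fZ fx0; apply: nU0; rewrite -fx0.
have mW : m W = 0.
  rewrite mh//; last by apply/seteqP; split=> // t [/not_orP[]].
  rewrite -(tm_set0 hmu); congr mu; apply/seteqP; split=> // x /not_orP[+ _].
  by apply; exists x.
have mF : measurable (factor h f @^-1` U : set (measurableTypeR R)).
  rewrite -[_ @^-1` _]setTI; apply: (measurable_factor h0 hf) => //.
  exact: open_measurable.
apply/eqP; rewrite eq_le; apply/andP; split.
  apply: le_measure; rewrite ?inE//; first exact: open_measurable.
  move=> t /= Ut; have [[x _ hx]|ht] := pselect (range h t); last first.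
    by move: Ut; rewrite (factor_out _ ht).
  move: Ut; rewrite -hx (factorE _ hf) => Ufx; apply/not_orP; split.
    by move=> [y nUy /fh yx]; apply: nUy; rewrite /= yx.
  by move=> /fZ fx0; apply: nU0; rewrite -fx0.
rewrite -[leRHS]adde0 -mW; apply: le_trans (measureU2 _ mF (open_measurable oW)).
apply: le_measure; rewrite ?inE; first exact: open_measurable.
  by apply: measurableU => //; exact: open_measurable.
move=> t /not_orP[nft nZt]; have [[x _ hx]|ht] := pselect (range h t); last first.
  by right; apply/not_orP.
left; rewrite /= -hx (factorE _ hf); apply: contrapT => nUfx.
by apply: nft; exists x.
Qed.

Lemma integrable_factor f : fiber_algebra h Z f ->
  m.-integrable setT (EFin \o factor h f).
Proof.
move=> hf; apply: measurable_bounded_integrable => //.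
  exact: (measurable_factor h0 hf).
have [f0 _ _] := hf.
have [M hM] := C0_bounded f0.
exists (Num.max 0 M)%R; split; first exact: num_real.
move=> K MK t _ /=; apply: (@factor_all h f (fun s => `|s| <= K)%R); rewrite ?normr0.
  by apply: ltW; apply: le_lt_trans MK; rewrite le_max lexx.
move=> x; apply: le_trans (hM x) _; apply: ltW; apply: le_lt_trans MK.
by rewrite le_max lexx orbT.
Qed.

(** Change of variables: the pushforward of [m] along [factor h f] agrees with [m'] on open sets
    avoiding 0, which determines the integral of the identity. *)
Lemma Rintegral_factor (m' : {measure set (measurableTypeR R) -> \bar R}) f :
  fiber_algebra h Z f -> represents mu m' [set 0%R] f -> m' setT < +oo ->
  (\int[m']_(t in setT) t = \int[m]_(t in setT) factor h f t)%R.
Proof.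
move=> hf m'f m'oo; have mphi := measurable_factor h0 hf.
have [pm pmE] : exists pm : {measure set (measurableTypeR R) -> \bar R},
    pm = pushforward m (factor h f : measurableTypeR R -> measurableTypeR R)
      :> (set _ -> _).
  by unshelve eexists; [refine (pushforward m _); exact: mphi|].
rewrite (@eq_Rintegral_off0 _ m' pm)//; last first.
  by move=> U oU U0; rewrite m'f// pmE /pushforward measure_factor.
rewrite /Rintegral pmE (integral_pushforward mphi)//.
exact: integrable_factor.
Qed.

End Factor.

(** * The functionals *)

Section Support.
Local Open Scope ring_scope.
Local Open Scope ereal_scope.
Context {R : realType}.
Variable m : {measure set (measurableTypeR R) -> \bar R}.

(** Every point off the support lies in a null interval with rational endpoints, and there are only
    countably many of these. *)
Lemma measure_setC_msupport :
  measurable (~` msupport m : set (measurableTypeR R)) /\ m (~` msupport m) = 0.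
Proof.
(* Intervals of positive measure are replaced by [set0], so that the union can run over all pairs of
   rationals. *)
pose J (pq : rat * rat) : set (measurableTypeR R) :=
  if m `]ratr pq.1, ratr pq.2[%classic == 0 then `]ratr pq.1, ratr pq.2[%classic
  else set0.
have mJ pq : measurable (J pq).
  by rewrite /J; case: ifPn => _; [exact: measurable_itv|exact: measurable0].
have J0 pq : m (J pq) = 0 by rewrite /J; case: ifPn => [/eqP//|_]; rewrite measure0.
pose F n := oapp J set0 (unpickle n).
have mF n : measurable (F n) by rewrite /F; case: unpickle => [pq|]/=.
have F0 n : m (F n) = 0 by rewrite /F; case: unpickle => [pq|]//=; rewrite measure0.
have -> : ~` msupport m = \bigcup_n F n.
  apply/seteqP; split=> [x /existsNP[U /not_implyP[oU /not_implyP[Ux mU]]]|].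
    have {}mU : m U = 0.
      by apply/eqP; rewrite eq_le measure_ge0 andbT leNgt; exact/negP.
    have /nbhs_ballP[e /= e0 xeU] : nbhs x U by apply: open_nbhs_nbhs.
    have [p] := @rat_in_itvoo R (x - e)%R x ltac:(by rewrite ltrBlDr ltrDl).
    rewrite in_itv/= => /andP[xp px].
    have [q] := @rat_in_itvoo R x (x + e)%R ltac:(by rewrite ltrDl).
    rewrite in_itv/= => /andP[xq qx].
    have FE : F (pickle (p, q)) = J (p, q) by rewrite /F pickleK.
    exists (pickle (p, q)); [exact: I|rewrite FE /J/=].
    rewrite ifT; first by rewrite /= in_itv/= px xq.
    rewrite eq_le measure_ge0 andbT -mU; apply: le_measure; rewrite ?inE.
    - exact: measurable_itv.
    - exact: open_measurable.
    - move=> y /=; rewrite in_itv/= => /andP[py yq]; apply: xeU.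
      by rewrite /ball/= ltr_norml; apply/andP; split; lra.
  move=> x [n _]; rewrite /F; case: unpickle => [[p q]|]//=.
  rewrite /J/=; case: ifPn => // /eqP mpq xpq /(_ _ (interval_open _ _) xpq).
  by rewrite mpq ltxx => absurd; case: (absurd isT isT).
split; first exact: bigcup_measurable.
by apply: measure_negligible; [exact: bigcup_measurable|
  apply: negligible_bigcup => k; apply/negligibleP; [exact: mF|exact: F0]].
Qed.

(** Reduces the bound of case (B) to one by the total mass. *)
Lemma measure_msupport : m (msupport m) = m setT.
Proof.
pose S : set (measurableTypeR R) := msupport m.
have [mS S0] : measurable (~` S) /\ m (~` S) = 0 := measure_setC_msupport.
have mS' : measurable S by rewrite -[S]setCK; exact: measurableC.
have -> : m setT = m S + m (~` S) by rewrite -measureU ?setUv// setICr.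
by rewrite S0 adde0.
Qed.

End Support.

(** * Quasi-linearity and bounds from representing measures *)

Section QuasiLinear.
Local Open Scope ring_scope.
Local Open Scope ereal_scope.
Context {R : realType} {X : topologicalType}.
Variable mu : set X -> \bar R.
Hypotheses (hX : hausdorff_space X) (hmu : topological_measure mu).
Implicit Types (m : {measure set (measurableTypeR R) -> \bar R}) (f h : X -> R).

(** [factor f f] is the identity on the range of [f] and 0 elsewhere, so pointwise bounds on [f]
    that 0 also satisfies become bounds on the integrand over the whole line. *)
Lemma Rintegral_factor_self m f : C0 f -> represents mu m [set 0%R] f ->
  m setT < +oo ->
  (\int[m]_(t in setT) t = \int[m]_(t in setT) factor f f t)%R.
Proof.
by move=> f0 mf moo; apply: (Rintegral_factor hX hmu f0 mf) => //; right.
Qed.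

Lemma fiber_algebra_self f : C0 f -> fiber_algebra f [set 0%R] f.
Proof. by split. Qed.

Lemma Rintegral_represents_le m f (M : R) : C0 f -> represents mu m [set 0%R] f ->
  m setT < +oo -> (0 <= M)%R -> (forall x, f x <= M)%R ->
  (\int[m]_(t in setT) t)%R%:E <= M%:E * m setT.
Proof.
move=> f0 mf moo M0 fM; have mfin : m setT \is a fin_num by rewrite ge0_fin_numE.
rewrite (Rintegral_factor_self f0 mf moo) -(fineK mfin) -EFinM lee_fin.
rewrite -Rintegral_cst//; apply: le_Rintegral => //.
- by apply: (integrable_factor hX f0 moo (fiber_algebra_self f0)).
- apply: measurable_bounded_integrable => //; exists M.
  by split=> [|K MK t _ /=]; [exact: num_real|rewrite ger0_norm// ltW].
- by move=> t _; exact: (@factor_all _ _ f f (fun s => s <= M)%R).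
Qed.

(* Values of the generator at which every element of the algebra must vanish. *)
Definition zero_value : set R := [set t | t = 0%R /\ ~ compact [set: X]].

(** Common to both cases. The measures [st f] that define the functional have to be right only off
    0; additivity on the algebra of [h] takes one measure for [h] that is also right at 0 when [X]
    is compact, whence the separate last hypothesis. *)
Lemma quasi_linear_represented (B : set (X -> R))
    (st : (X -> R) -> {measure set (measurableTypeR R) -> \bar R}) :
  B `<=` C0 -> (forall h, B h -> gen_subalgebra h `<=` B) ->
  (forall f, B f -> represents mu (st f) [set 0%R] f /\ st f setT < +oo) ->
  (forall h, B h -> exists2 m, represents mu m zero_value h & m setT < +oo) ->
  quasi_linear B (fun f => \int[st f]_(t in setT) t)%R.
Proof.
move=> BC0 Bgen Bst Bex.
have cXZ : compact [set: X] -> zero_value = set0.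
  by move=> cX; apply/seteqP; split=> // t [].
split.
- move=> a f Bf; have [mf moo] := Bst _ Bf; have f0 := BC0 _ Bf.
  have Baf : B (a \*o f).
    by apply: Bgen Bf _ _ => A [cA /(_ _ erefl) Af]; exact: csubZ.
  have [maf mafoo] := Bst _ Baf.
  have hf := fiber_algebra_self f0.
  (* Homogeneity uses [f] as its own generator: a multiple of [f] vanishes where [f] does. *)
  have haf : fiber_algebra f [set 0%R] (a \*o f).
    split; first exact: BC0.
      by move=> x y /= ->.
    by move=> x /= ->; rewrite mulr0.
  rewrite (Rintegral_factor_self f0 mf moo).
  rewrite (Rintegral_factor hX hmu f0 mf moo _ _ haf maf mafoo)//; last by right.
  rewrite -RintegralZl//; last exact: (integrable_factor hX f0 moo hf).
  by apply: eq_Rintegral => t _; rewrite factorZ.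
- move=> h f g Bh hf hg; have h0 := BC0 _ Bh.
  have hfg : gen_subalgebra h (f \+ g)%R.
    by move=> A AP; apply: (csubD AP.1); [exact: hf|exact: hg].
  have [m mh moo] := Bex _ Bh.
  have Z0 : zero_value `<=` [set 0%R] by move=> t [].
  have XZ : compact [set: X] \/ zero_value 0%R.
    by have [cX|ncX] := pselect (compact [set: X]); [left|right].
  (* [f], [g] and their sum are all integrated against the same [m], so linearity of the integral
     applies. *)
  have E k : gen_subalgebra h k -> fiber_algebra h zero_value k /\
      (\int[st k]_(t in setT) t = \int[m]_(t in setT) factor h k t)%R.
    move=> hk; have hk' := gen_subalgebra_fiber cXZ Z0 h0 hk.
    have [mk mkoo] := Bst _ (Bgen _ Bh _ hk).
    by split => //; exact: (Rintegral_factor hX hmu h0 mh moo Z0 XZ hk' mk mkoo).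
  have [hf' ->] := E _ hf; have [hg' ->] := E _ hg; have [_ ->] := E _ hfg.
  rewrite -RintegralD//; [|exact: (integrable_factor hX h0 moo hf')|
    exact: (integrable_factor hX h0 moo hg')].
  by apply: eq_Rintegral => t _; rewrite factorD.
- move=> f Bf f_ge0; have [mf moo] := Bst _ Bf.
  rewrite (Rintegral_factor_self (BC0 _ Bf) mf moo); apply: Rintegral_ge0 => t _.
  exact: (@factor_all _ _ f f (fun s => 0 <= s)%R).
Qed.

Lemma represents_sub m (Z Z' : set R) f : Z `<=` Z' -> represents mu m Z f ->
  represents mu m Z' f.
Proof.
by move=> ZZ' mf U oU UZ'; apply: mf => //; rewrite -subset0 -UZ'; exact: setIS.
Qed.

Lemma unorm_ge f x : Cb f -> (`|f x| <= unorm f)%R.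
Proof.
move=> [_ [M fM]]; apply: sup_ubound; last by exists x.
by exists M => _ [y _ <-].
Qed.

Lemma unorm_ge0 f : Cb f -> (0 <= unorm f)%R.
Proof.
move=> fb; have [[x _]|X0] := pselect ([set: X] !=set0).
  exact: le_trans (unorm_ge x fb).
rewrite /unorm [X in sup X](_ : _ = set0) ?sup0//.
by apply/seteqP; split=> // t [x _ _]; case: X0; exists x.
Qed.

End QuasiLinear.

Unset Implicit Arguments.

Theorem theorem30 (R : realType) (X : topologicalType) (mu : set X -> \bar R)
    (hX : hausdorff_space X) (lcX : locally_compact [set: X])
    (cX : connected [set: X]) (hmu : topological_measure mu) :
  (mu [set: X] < +oo ->
    quasi_linear C0 (rhoA mu) /\ ql_norm C0 (rhoA mu) <= mu [set: X])
  /\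
  (compact_finite mu ->
    quasi_linear Cc (rhoB mu) /\
    forall f : X -> R, Cc f ->
      (rhoB mu f)%:E <=
        (unorm f)%:E * stieltjes (tailB mu f) (msupport (stieltjes (tailB mu f)))).
Proof.
(* In case (A) the tails keep the value 0, so the measure is right on every open set and serves for
   any [Z]. *)
have reprA f : C0 f -> mu [set: X] < +oo -> forall Z,
    represents mu (stieltjes (tailA mu f)) Z f /\
    stieltjes (tailA mu f) setT < +oo.
  move=> f0 muoo Z; have [mf mT] := stieltjes_tailA hmu hX f0 muoo.
  by split; [exact: (represents_sub (@sub0set _ Z) mf)|rewrite mT].
split=> [muoo|fin]; split.
- apply: (quasi_linear_represented hX hmu) => //.
  + move=> h h0; apply: smallest_sub; last by move=> _ ->.
    exact: C0_closed_subalgebra.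
  + by move=> f f0; exact: reprA.
  + by move=> h h0; have [] := reprA h h0 muoo (@zero_value R X); exists (stieltjes (tailA mu h)).
- apply: ge_ereal_sup => _ [f [f0 f01] <-].
  have [_ mT] := stieltjes_tailA hmu hX f0 muoo.
  have [mf moo] := reprA f f0 muoo [set 0%R].
  (* The total mass of the Stieltjes measure is [mu [set: X]], so the bound with constant 1 is the
     claim. *)
  rewrite -mT -[leRHS]mul1e; apply: (Rintegral_represents_le hX hmu f0 mf moo) => //.
  by move=> x; have /andP[] := f01 x.
- apply: (quasi_linear_represented hX hmu).
  + exact: Cc_C0.
  + exact: Cc_gen_subalgebra.
  + by move=> f fc; exact: stieltjes_tailB.
  + move=> h hc; have [cX'|ncX] := pselect (compact [set: X]).
      (* Compactness makes [mu [set: X]] finite, so the measure of case (A), which is also right at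
         0, is available. *)
      have [] := reprA h (Cc_C0 hc) (fin _ cX') (@zero_value R X).
      by exists (stieltjes (tailA mu h)).
    have [mh moo] := stieltjes_tailB hmu hX hc fin.
    exists (stieltjes (tailB mu h)) => //.
    by apply: (represents_sub _ mh) => _ ->.
- move=> f fc; have f0 := Cc_C0 fc; have fb := C0_Cb f0.
  have [mf moo] := stieltjes_tailB hmu hX fc fin.
  rewrite measure_msupport; apply: (Rintegral_represents_le hX hmu f0 mf moo).
    exact: unorm_ge0.
  by move=> x; apply: le_trans (ler_norm _) (unorm_ge x fb).
Qed.
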